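(* Consider a two-stage covering stochastic problem with $K$ scenarios. Let $z^*$ be the optimal objective value obtained after adding all weak specific-scenario cuts. Then $$z^*\ge\frac1Kz^I .$$
   Context: A two-stage covering stochastic problem with $K$ scenarios is a mixed integer linear program of the form: minimize $c^Ty+\sum_{i=1}^K(d^i)^Tz^i$ subject to constraints involving only first-stage variables, $Ay\ge b$, and, for each $i=1,\dots,K$, constraints $A^iy+B^iz^i\ge b^i$; here $y$ are the first-stage variables, $z^i$ the second-stage variables of scenario $i$, all variables are nonnegative, a specified subset of variables is required to be integer, and all matrices, right-hand sides and objective vectors have nonnegative rational entries. Let $P$ be the feasible region, $P^I$ its convex hull, $P^{LP}$ the feasible region of the linear programming relaxation, and $z^I$ the minimum of the objective over $P^I$. Weak specific-scenario cuts: the rows of the constraint system are partitioned into $K$ blocks $I_1,\dots,I_K$, where block $I_i$ contains the rows $A^iy+B^iz^i\ge b^i$ of scenario $i$ (and each row involving only first-stage variables is placed in one of the blocks). Let $N_i$ be the set of variables that have a nonzero coefficient in at least one row of $I_i$. A weak specific-scenario cut is a linear inequality valid for $P^I$ whose coefficients vanish outside $N_i$ for some $i\in\{1,\dots,K\}$. $z^*$ is the minimum of the objective over the points of $P^{LP}$ that satisfy all weak specific-scenario cuts. *)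

(* Defs.v *)
From HB Require Import structures.
From mathcomp Require Import all_boot all_order all_algebra.
From mathcomp Require Import all_classical all_reals all_analysis.

Set Implicit Arguments.
Unset Strict Implicit.
Unset Printing Implicit Defensive.

Import Order.TTheory GRing.Theory Num.Theory.
Local Open Scope classical_set_scope.
Local Open Scope ring_scope.

Section ConvexHull.
Variables (R : realType) (V : lmodType R).

Definition convex_hull (S : set V) : set V :=
  [set x | exists (n : nat) (w : 'I_n -> R) (p : 'I_n -> V),
    [/\ forall t, 0 <= w t, \sum_t w t = 1, forall t, S (p t)
      & x = \sum_t w t *: p t]].

End ConvexHull.

(* Data of
     min  c^T y + \sum_i (d^i)^T z^i
     s.t. A y >= b,  A^i y + B^i z^i >= b^i  (i < K),  y, z^i >= 0,
          y_j integer for j in ints1,  z^i_j integer for j in ints2 i.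
   The number of variables and rows may depend on the scenario. *)
Record two_stage (K : nat) := TwoStage {
  dim1 : nat;
  dim2 : 'I_K -> nat;
  nrows1 : nat;
  nrows2 : 'I_K -> nat;
  cost1 : 'cV[rat]_dim1;
  cost2 : forall i, 'cV[rat]_(dim2 i);
  mxA1 : 'M[rat]_(nrows1, dim1);
  rhs1 : 'cV[rat]_nrows1;
  mxA2 : forall i, 'M[rat]_(nrows2 i, dim1);
  mxB2 : forall i, 'M[rat]_(nrows2 i, dim2 i);
  rhs2 : forall i, 'cV[rat]_(nrows2 i);
  ints1 : {set 'I_dim1};
  ints2 : forall i, {set 'I_(dim2 i)} }.

Definition covering K (Q : two_stage K) : Prop :=
  [/\ cost1 Q \is a mxOver Num.nneg,
      mxA1 Q \is a mxOver Num.nneg,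
      rhs1 Q \is a mxOver Num.nneg
    & forall i : 'I_K,
      [/\ cost2 Q i \is a mxOver Num.nneg,
          mxA2 Q i \is a mxOver Num.nneg,
          mxB2 Q i \is a mxOver Num.nneg
        & rhs2 Q i \is a mxOver Num.nneg]].

(* [inl j] is y_j and [inr (Tagged _ j)], with tag i, is z^i_j. *)
Definition var K (Q : two_stage K) : finType :=
  ('I_(dim1 Q) + {i : 'I_K & 'I_(dim2 Q i)})%type.

Definition yvar K (Q : two_stage K) (j : 'I_(dim1 Q)) : var Q := inl j.

Definition zvar K (Q : two_stage K) (i : 'I_K) (j : 'I_(dim2 Q i)) : var Q :=
  inr (Tagged (fun i => 'I_(dim2 Q i)) j).

Section Problem.
Variables (R : realType) (K : nat) (Q : two_stage K).

Definition point : lmodType R := {ffun var Q -> R}.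

Definition ypart (x : point) : 'cV[R]_(dim1 Q) := \col_j x (yvar j).

Definition zpart (x : point) (i : 'I_K) : 'cV[R]_(dim2 Q i) :=
  \col_j x (zvar j).

Local Notation toR M := (map_mx (ratr : rat -> R) M).

Definition objective (x : point) : R :=
  ((toR (cost1 Q))^T *m ypart x) 0 0 +
  \sum_(i < K) ((toR (cost2 Q i))^T *m zpart x i) 0 0.

Definition PLP : set point :=
  [set x | [/\ forall r, (toR (rhs1 Q)) r 0 <= (toR (mxA1 Q) *m ypart x) r 0,
               forall i r, (toR (rhs2 Q i)) r 0 <=
                 (toR (mxA2 Q i) *m ypart x + toR (mxB2 Q i) *m zpart x i) r 0
             & forall v, 0 <= x v]].

Definition P : set point :=
  [set x | [/\ PLP x,
               forall j, j \in ints1 Q -> x (yvar j) \is a Num.int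
             & forall i j, j \in ints2 Q i -> x (zvar j) \is a Num.int]].

Definition PI : set point := convex_hull P.

(* Optimal value of minimizing the objective over S.  Being an infimum in the
   extended reals, it is the minimum whenever that is attained, and +oo when S
   is empty. *)
Definition min_value (S : set point) : \bar R :=
  ereal_inf [set (objective x)%:E | x in S].

Definition zI : \bar R := min_value PI.

(* [blk r] is the block in which the r-th row of A y >= b is placed; block i
   consists of the rows of scenario i and of the rows r with blk r = i. *)
Definition block_vars (blk : 'I_(nrows1 Q) -> 'I_K) (i : 'I_K) : {set var Q} :=
  [set yvar j | j : 'I_(dim1 Q) &
      [exists r, (blk r == i) && (mxA1 Q r j != 0)]
      || [exists r, mxA2 Q i r j != 0]]
  :|: [set zvar j | j : 'I_(dim2 Q i) & [exists r, mxB2 Q i r j != 0]].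

(* The pair (a, beta) stands for the inequality \sum_v a_v x_v >= beta. *)
Definition weak_cut (blk : 'I_(nrows1 Q) -> 'I_K) (a : point) (beta : R) : Prop :=
  (forall x, PI x -> beta <= \sum_v a v * x v) /\
  (exists i : 'I_K, forall v, v \notin block_vars blk i -> a v = 0).

Definition weak_cut_closure (blk : 'I_(nrows1 Q) -> 'I_K) : set point :=
  [set x | PLP x /\
           forall a beta, weak_cut blk a beta -> beta <= \sum_v a v * x v].

Definition zstar (blk : 'I_(nrows1 Q) -> 'I_K) : \bar R :=
  min_value (weak_cut_closure blk).

End Problem.

(* Main.v *)
(** Fix [x] satisfying all weak cuts, and let [N_i] be the variables of block
    [i].  The projection of [x] to [N_i] lies in the closure of the projection
    of [PI]: otherwise the hyperplane through the nearest point of that closure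
    would be a violated weak cut.  So for every [d > 0] some [p_i] in [PI] is
    [d]-close to [x] on [N_i].  Set the coordinates of [p_i] outside [N_i] to
    zero and add up over [i].  If the [p_i] were in [P], the sum would be in [P],
    since every row only involves one [N_i] and all coefficients are
    nonnegative; in general it is a convex combination of such sums, hence in
    [PI].  Each coordinate of the sum is at most [K (x_v + d)], so [zI] is at
    most [K] times the objective of [x] plus [O(d)].  Working with approximate
    points avoids having to show that [PI] is closed. *)
Require Import Defs.
From HB Require Import structures.
From mathcomp Require Import all_boot all_order all_algebra.
From mathcomp Require Import all_classical all_reals all_analysis.
From mathcomp Require Import ring lra.

Set Implicit Arguments.
Unset Strict Implicit.
Unset Printing Implicit Defensive.

Import Order.TTheory GRing.Theory Num.Theory.
Import numFieldNormedType.Exports.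
Local Open Scope classical_set_scope.
Local Open Scope ring_scope.

(** * Convex sets and convex hulls *)

Definition convex (R : realType) (V : lmodType R) (C : set V) : Prop :=
  forall (t : R) p q, 0 <= t -> t <= 1 -> C p -> C q ->
    C (t *: p + (1 - t) *: q).

Lemma sub_convex_hull (R : realType) (V : lmodType R) (S : set V) :
  S `<=` convex_hull S.
Proof.
by move=> x Sx; exists 1, (fun=> 1), (fun=> x); split; rewrite ?big_ord1 ?scale1r.
Qed.

Lemma convex_hull_fin (R : realType) (V : lmodType R) (S : set V)
    (I : finType) (w : I -> R) (p : I -> V) :
  (forall i, 0 <= w i) -> \sum_i w i = 1 -> (forall i, S (p i)) ->
  convex_hull S (\sum_i w i *: p i).
Proof.
move=> w0 w1 Sp; exists #|I|, (w \o enum_val), (p \o enum_val).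
split=> [t||t|] /=; first exact: w0.
- by rewrite -w1 [RHS](reindex _ (onW_bij _ (enum_val_bij I))).
- exact: Sp.
- by rewrite (reindex _ (onW_bij _ (enum_val_bij I))).
Qed.

Lemma convex_hull_convex (R : realType) (V : lmodType R) (S : set V) :
  convex (convex_hull S).
Proof.
move=> t _ _ t0 t1 [m [w [p [w0 w1 Sp ->]]]] [n [u [q [u0 u1 Sq ->]]]].
pose c (i : 'I_m + 'I_n) :=
  match i with inl i => t * w i | inr j => (1 - t) * u j end.
pose r (i : 'I_m + 'I_n) := match i with inl i => p i | inr j => q j end.
have -> : t *: (\sum_i w i *: p i) + (1 - t) *: (\sum_i u i *: q i) =
    \sum_i c i *: r i.
  rewrite big_sumType /= !scaler_sumr.
  by congr (_ + _); apply: eq_bigr => i _; rewrite scalerA.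
apply: convex_hull_fin.
- by case=> i /=; apply: mulr_ge0 => //; rewrite subr_ge0.
- by rewrite big_sumType /= -!mulr_sumr w1 u1 !mulr1 addrC subrK.
- by case.
Qed.

Lemma convex_hull_linear (R : realType) (V W : lmodType R)
    (f : {linear V -> W}) (S : set V) x :
  convex_hull S x -> convex_hull (f @` S) (f x).
Proof.
move=> [n [w [p [w0 w1 Sp ->]]]]; exists n, w, (f \o p); split=> //.
  by move=> t; exists (p t).
by rewrite linear_sum; apply: eq_bigr => i _; rewrite linearZ.
Qed.

(** Use the product weights [w i * u j] on the sums [p i + q j]: each family of weights sums to 1,
    so the marginals give back both combinations. *)
Lemma convex_hull_add (R : realType) (V : lmodType R) (A B S : set V) a b :
  (forall a b, A a -> B b -> S (a + b)) ->
  convex_hull A a -> convex_hull B b -> convex_hull S (a + b).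
Proof.
move=> AB [m [w [p [w0 w1 Ap ->]]]] [n [u [q [u0 u1 Bq ->]]]].
have -> : \sum_i w i *: p i + \sum_i u i *: q i =
    \sum_(ij : 'I_m * 'I_n) (w ij.1 * u ij.2) *: (p ij.1 + q ij.2).
  rewrite -(pair_bigA _ (fun i j => (w i * u j) *: (p i + q j))) /=.
  set c := \sum_j u j *: q j.
  have inner i : \sum_j (w i * u j) *: (p i + q j) = w i *: p i + w i *: c.
    under eq_bigr => j _ do rewrite -scalerA scalerDr.
    by rewrite -scaler_sumr big_split /= -scaler_suml u1 scale1r scalerDr.
  by rewrite (eq_bigr _ (fun i _ => inner i)) big_split /= -scaler_suml w1 scale1r.
apply: convex_hull_fin.
- by move=> ij; apply: mulr_ge0.
- rewrite -(pair_bigA _ (fun i j => w i * u j)) /=.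
  by under eq_bigr => i _ do rewrite -mulr_sumr u1 mulr1.
- by move=> ij; apply: AB.
Qed.

Lemma convex_hull_sum (R : realType) (V : lmodType R) (I : eqType) (r : seq I)
    (A : I -> set V) (S : set V) (y : I -> V) :
  uniq r -> (forall f, (forall i, i \in r -> A i (f i)) -> S (\sum_(i <- r) f i)) ->
  (forall i, i \in r -> convex_hull (A i) (y i)) ->
  convex_hull S (\sum_(i <- r) y i).
Proof.
elim: r S => [|i r IH] S.
  move=> _ SA _; apply: sub_convex_hull.
  rewrite big_nil; have := SA (fun=> 0); rewrite big_nil; exact.
move=> /= /andP[ir ur] SA Ay; rewrite big_cons.
(* The tail is represented by the set of all its admissible sums, to which the induction hypothesis,
   general in [S], applies. *)
apply: (convex_hull_add (A := A i)
    (B := [set \sum_(j <- r) f j | f in [set f | forall j, j \in r -> A j (f j)]])).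
- move=> a _ Aa [f Af <-].
  (* Overwriting [f] at [i] leaves the tail sum unchanged, as [i] is not in [r]. *)
  have := SA (fun j => if j == i then a else f j).
  rewrite big_cons eqxx (@eq_big_seq _ _ _ _ r _ f); last first.
    by move=> j jr; case: eqP => // ji; rewrite -ji jr in ir.
  apply=> j; rewrite inE; case: eqP => [-> //|_ /= jr]; exact: Af.
- by apply: Ay; rewrite mem_head.
- apply: IH => // [f Af|j jr]; first by exists f.
  by apply: Ay; rewrite inE jr orbT.
Qed.

(** * Separating a point from the closure of a convex set *)

Lemma closure_convex (R : realType) n (C : set 'rV[R]_n) (t : R) p z :
  convex C -> 0 <= t -> t <= 1 -> C p -> closure C z ->
  closure C (t *: p + (1 - t) *: z).
Proof.
move=> Cc t0 t1 Cp Cz B Bn.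
have cont : {for z, continuous (fun w : 'rV[R]_n => t *: p + (1 - t) *: w)}.
  by apply: continuousD; [exact: cst_continuous | exact: scaler_continuous].
have [w [Cw Bw]] := Cz _ (cont _ Bn).
by exists (t *: p + (1 - t) *: w); split=> //; apply: Cc.
Qed.

Lemma sqr_le_sum (R : realType) (I : finType) (f : I -> R) i :
  f i ^+ 2 <= \sum_j f j ^+ 2.
Proof. by rewrite (bigD1 i) //= lerDl sumr_ge0 // => j _; rewrite sqr_ge0. Qed.

(** Squared Euclidean distance: the norm on row vectors is the sup norm, whose nearest points need
    not yield the hyperplane used below. *)
Definition dist2 (R : realType) n (x w : 'rV[R]_n) : R :=
  \sum_j (w 0 j - x 0 j) ^+ 2.

Lemma continuous_dist2 (R : realType) n (x : 'rV[R]_n) : continuous (dist2 x).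
Proof.
apply: (continuous_big (op := +%R)) => [z|j _ z]; first exact: add_continuous.
have c : {for z, continuous (fun w : 'rV[R]_n => w 0 j - x 0 j)}.
  by apply: continuousB; [exact: coord_continuous | exact: cst_continuous].
exact: (continuousM c c).
Qed.

Lemma dist2_coord (R : realType) n (x w : 'rV[R]_n) j :
  `|w 0 j - x 0 j| <= dist2 x w + 1.
Proof.
have := sqr_le_sum (fun j => w 0 j - x 0 j) j; rewrite -/(dist2 x w).
rewrite -real_normK ?num_real //; have := normr_ge0 (w 0 j - x 0 j); nra.
Qed.

(** It suffices to minimize over the points of the closure no farther from [x] than some [q0] in
    [C]; these form a compact set. *)
Lemma nearest_point (R : realType) n (C : set 'rV[R]_n) (x : 'rV[R]_n) :
  C !=set0 ->
  exists2 z, closure C z & forall w, closure C w -> dist2 x z <= dist2 x w.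
Proof.
move=> [q0 Cq0]; pose D := closure C `&` [set w | dist2 x w <= dist2 x q0].
have Dq0 : D q0 by split; [exact: subset_closure | exact: lexx].
have cD : compact D.
  apply: bounded_closed_compact; last first.
    apply: closedI; first exact: closed_closure.
    apply: (@closed_comp _ _ (dist2 x) [set r | r <= dist2 x q0]).
      by move=> w _; exact: continuous_dist2.
    exact: closed_le.
  exists (`|x| + dist2 x q0 + 1); split; first exact: num_real.
  move=> M ltM w [_ /= le_w].
  rewrite [leLHS]/Num.Def.normr/= mx_normrE; apply/bigmax_leP; split=> [|[i j] _ /=].
    apply: le_trans (ltW ltM).
    by rewrite addr_ge0 // addr_ge0 // sumr_ge0 // => j _; rewrite sqr_ge0.
  have xj : `|x i j| <= `|x|.
    by rewrite [leRHS]/Num.Def.normr/= mx_normrE; apply/bigmax_geP; right; exists (i, j).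
  have := dist2_coord x w j; have := ler_normD (w i j - x i j) (x i j).
  by rewrite subrK !ord1 in xj *; move: ltM le_w xj; lra.
have [z] := EVT_min_rV (ex_intro _ q0 Dq0) cD
  (continuous_subspaceT (@continuous_dist2 R n x)).
rewrite inE => -[Cz zq0] zmin; exists z => // w Cw.
have [le_w|/ltW] := leP (dist2 x w) (dist2 x q0); last exact: le_trans.
by apply: zmin; rewrite inE.
Qed.

(** Let [z] be nearest to [x] and [a = z - x]. The inequality [a q >= a z] is valid on [C], so [x]
    satisfies it, which says that the squared distance from [x] to [z] is at most 0. *)
Lemma closure_of_valid_inequalities (R : realType) n (C : set 'rV[R]_n) (x : 'rV[R]_n) :
  convex C ->
  (forall (a : 'rV[R]_n) (beta : R),
    (forall q, C q -> beta <= \sum_j a 0 j * q 0 j) ->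
    beta <= \sum_j a 0 j * x 0 j) ->
  closure C x.
Proof.
move=> Cc valid.
have C0 : C !=set0.
  have [//|nC] := pselect (C !=set0).
  (* If [C] were empty, [0 >= 1] would be a valid inequality. *)
  have := valid 0 1 (fun q Cq => False_ind _ (nC (ex_intro _ q Cq))).
  by rewrite big1 ?ler10 // => j _; rewrite mxE mul0r.
have [z Cz zmin] := nearest_point x C0.
suff -> : x = z by [].
pose a := z - x; pose S1 (q : 'rV[R]_n) := \sum_j a 0 j * (q 0 j - z 0 j).
have S1_ge0 q : C q -> 0 <= S1 q.
  move=> Cq; rewrite leNgt; apply/negP => S1lt.
  pose S2 := \sum_j (q 0 j - z 0 j) ^+ 2.
  have S2_ge0 : 0 <= S2 by apply: sumr_ge0 => j _; rewrite sqr_ge0.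
  have expand t : dist2 x (t *: q + (1 - t) *: z) =
      dist2 x z + t * (2 * S1 q + t * S2).
    rewrite /dist2 /S1 /S2 mulrDr !mulr_sumr -!big_split /=.
    by apply: eq_bigr => j _; rewrite /a !mxE; ring.
  (* With this [t], [2 * S1 q + t * S2 = (1 + t) * S1 q < 0], so moving from [z] towards [q] by [t]
     would come closer to [x]. *)
  pose t := - S1 q / (S2 - S1 q).
  have den : 0 < S2 - S1 q by lra.
  have t0 : 0 < t by rewrite divr_gt0 // oppr_gt0.
  have t1 : t <= 1 by rewrite ler_pdivrMr // mul1r; lra.
  have := zmin _ (closure_convex Cc (ltW t0) t1 Cq Cz).
  rewrite expand lerDl pmulr_rge0 //.
  have tE : t * (S2 - S1 q) = - S1 q by rewrite divfK // gt_eqF.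
  nra.
have /valid : forall q, C q -> \sum_j a 0 j * z 0 j <= \sum_j a 0 j * q 0 j.
  move=> q /S1_ge0; rewrite /S1 -[X in _ -> is_true X]subr_ge0 -sumrB.
  by under eq_bigr do rewrite mulrBr.
rewrite -subr_ge0 -sumrB => le0.
have : \sum_j (a 0 j) ^+ 2 <= 0.
  rewrite -oppr_ge0 -sumrN; move: le0; congr (_ <= _).
  by apply: eq_bigr => j _; rewrite /a !mxE; ring.
move=> a0; apply/rowP => j; apply/eqP; rewrite eq_sym -subr_eq0 -sqrf_eq0.
rewrite eq_le sqr_ge0 andbT; apply: le_trans a0.
by have := sqr_le_sum (a 0) j; rewrite /a !mxE.
Qed.

(** * Projection to the variables of one block *)

Lemma approx_on (R : realType) (K : nat) (Q : two_stage K)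
    (C : set (Defs.point R Q)) (N : {set var Q}) (x : Defs.point R Q) (e : R) :
  0 < e -> convex C ->
  (forall (a : Defs.point R Q) (beta : R), (forall v, v \notin N -> a v = 0) ->
    (forall q, C q -> beta <= \sum_v a v * q v) ->
    beta <= \sum_v a v * x v) ->
  exists2 p, C p & forall v, v \in N -> `|p v - x v| <= e.
Proof.
move=> e0 Cc valid.
(* Coordinates outside [N] are zeroed rather than dropped, so that the dimension does not depend on
   [N]. *)
pose phi (p : Defs.point R Q) : 'rV[R]_#|var Q| :=
  \row_i (if enum_val i \in N then p (enum_val i) else 0).
have phi_in p v : v \in N -> phi p 0 (enum_rank v) = p v.
  by move=> vN; rewrite mxE enum_rankK vN.
have : closure (phi @` C) (phi x).
  apply: closure_of_valid_inequalities.
    move=> t _ _ t0 t1 [p Cp <-] [q Cq <-].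
    exists (t *: p + (1 - t) *: q); first exact: Cc.
    by apply/rowP => j; rewrite !mxE !ffunE; case: ifP => _ //; rewrite !mulr0 addr0.
  move=> a beta abeta.
  (* An inequality on the image pulls back to one supported on [N], as a weak cut must be. *)
  pose a' : Defs.point R Q := [ffun v => if v \in N then a 0 (enum_rank v) else 0].
  have a'E (p : Defs.point R Q) : \sum_v a' v * p v = \sum_j a 0 j * phi p 0 j.
    rewrite (reindex _ (onW_bij _ (enum_val_bij (var Q)))) /=.
    apply: eq_bigr => j _; rewrite ffunE mxE enum_valK.
    by case: ifP => _ //; rewrite mul0r mulr0.
  rewrite -a'E; apply: valid => [v vN|q Cq]; first by rewrite ffunE (negbTE vN).
  by rewrite a'E; apply: abeta; exists q.
move=> /(_ _ (nbhsx_ballx _ _ e0)) [_ [[p Cp <-]]].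
move=> xp; exists p => // v vN.
have [/= _ /(_ 0 (enum_rank v))] := xp; rewrite /ball_ !phi_in //= distrC.
exact: ltW.
Qed.

Definition restrict (R : realType) (K : nat) (Q : two_stage K)
  (N : {set var Q}) (p : Defs.point R Q) : Defs.point R Q :=
  [ffun v => if v \in N then p v else 0].

(** Linearity lets [convex_hull_linear] carry convex combinations through the restriction. *)
Lemma restrict_is_linear (R : realType) (K : nat) (Q : two_stage K)
  (N : {set var Q}) : linear (@restrict R K Q N).
Proof.
move=> a p q; apply/ffunP => v; rewrite !ffunE.
by case: ifP => _ //; rewrite scaler0 addr0.
Qed.

HB.instance Definition _ (R : realType) (K : nat) (Q : two_stage K)
    (N : {set var Q}) :=
  GRing.isLinear.Build R (Defs.point R Q) (Defs.point R Q) *:%R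
    (@restrict R K Q N) (@restrict_is_linear R K Q N).

Lemma ler_mulmx_row (R : realType) m n (M : 'M[rat]_(m, n)) (u w : 'cV[R]_n) r :
  M \is a mxOver Num.nneg ->
  (forall j, M r j != 0 -> u j 0 <= w j 0) ->
  (map_mx (ratr : rat -> R) M *m u) r 0 <= (map_mx (ratr : rat -> R) M *m w) r 0.
Proof.
move=> /mxOverP M0 uw; rewrite !mxE; apply: ler_sum => j _; rewrite mxE.
have [->|Mrj] := eqVneq (M r j) 0; first by rewrite rmorph0 !mul0r.
by apply: ler_wpM2l; [rewrite ler0q -nnegrE; exact: M0 | exact: uw].
Qed.

Lemma sum_restrict_feasible (R : realType) (K : nat) (Q : two_stage K)
    (blk : 'I_(nrows1 Q) -> 'I_K) (p : 'I_K -> Defs.point R Q) :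
  covering Q -> (forall i, P (p i)) ->
  P (\sum_i restrict (block_vars blk i) (p i)).
Proof.
move=> [_ A1 _ cov2] Pp; set q := \sum_i _.
have qE v : q v = \sum_i (if v \in block_vars blk i then p i v else 0).
  by rewrite /q sum_ffunE; apply: eq_bigr => i _; rewrite ffunE.
have p0 i v : 0 <= p i v by case: (Pp i) => -[].
have term0 v i : 0 <= (if v \in block_vars blk i then p i v else 0).
  by case: ifP.
have q_ge i v : v \in block_vars blk i -> p i v <= q v.
  by move=> vi; rewrite qE (bigD1 i) //= vi lerDl sumr_ge0.
split.
- split=> [r|i r|v]; last by rewrite qE sumr_ge0.
  + have [[Ap _ _] _ _] := Pp (blk r); apply: le_trans (Ap r) _.
    apply: ler_mulmx_row => // j Arj; rewrite !mxE; apply: q_ge.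
    rewrite inE; apply/orP; left; apply: imset_f; rewrite inE.
    by apply/orP; left; apply/existsP; exists r; rewrite eqxx.
  + have [_ A2 B2 _] := cov2 i.
    have [[_ Ap _] _ _] := Pp i; apply: le_trans (Ap i r) _.
    rewrite [leLHS]mxE [leRHS]mxE; apply: lerD; apply: ler_mulmx_row => // j Mrj;
      rewrite !mxE; apply: q_ge; rewrite inE; apply/orP; [left|right];
      apply: imset_f; rewrite inE.
    * by apply/orP; right; apply/existsP; exists r.
    * by apply/existsP; exists r.
- move=> j jint; rewrite qE; apply: rpred_sum => i _.
  by case: ifP => _; [case: (Pp i) => _ /(_ j jint) | exact: rpred0].
- move=> k j jint; rewrite qE; apply: rpred_sum => i _.
  by case: ifP => _; [case: (Pp i) => _ _ /(_ k j jint) | exact: rpred0].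
Qed.

(** * The objective as a single sum over all variables, and the final estimate *)

Definition cost (R : realType) (K : nat) (Q : two_stage K) (v : var Q) : R :=
  match v with
  | inl j => ratr (cost1 Q j 0)
  | inr t => ratr (cost2 Q (tag t) (tagged t) 0)
  end.

Lemma cost_ge0 (R : realType) (K : nat) (Q : two_stage K) (v : var Q) :
  covering Q -> 0 <= cost R v.
Proof.
move=> [/mxOverP c1 _ _ cov2]; case: v => [j|t]; rewrite /= ler0q -nnegrE //.
by have [/mxOverP c2 _ _ _] := cov2 (tag t).
Qed.

Lemma objectiveE (R : realType) (K : nat) (Q : two_stage K)
    (x : Defs.point R Q) :
  objective x = \sum_v cost R v * x v.
Proof.
rewrite big_sumType /=; congr (_ + _).
  by rewrite mxE; apply: eq_bigr => j _; rewrite !mxE.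
transitivity (\sum_i \sum_(j : 'I_(dim2 Q i)) ratr (cost2 Q i j 0) * x (zvar j)).
  by apply: eq_bigr => i _; rewrite mxE; apply: eq_bigr => j _; rewrite !mxE.
by rewrite sig_big_dep; apply: eq_bigr => -[i j].
Qed.

Theorem corollary23 (R : realType) (K : nat) (hK : (0 < K)%N)
    (Q : two_stage K) (hQ : covering Q)
    (blk : 'I_(nrows1 Q) -> 'I_K) :
  ((K%:R^-1)%:E * zI R Q <= zstar R blk)%E.
Proof.
apply/ereal_infP => _ [x [[_ _ x0] cut] <-].
have K0 : 0 < K%:R :> R by rewrite ltr0n.
suff zI_le : (zI R Q <= (K%:R * objective x)%:E)%E.
  rewrite -[objective x](mulKf (lt0r_neq0 K0)) EFinM.
  by apply: lee_wpmul2l => //; rewrite lee_fin invr_ge0 ltW.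
apply/lee_addgt0Pr => e e0.
pose c := \sum_(v : var Q) cost R v.
have c0 : 0 <= c by apply: sumr_ge0 => v _; exact: cost_ge0.
(* Chosen so that the total error [K%:R * c * d] is at most [e]; the [+ 1] keeps the denominator
   positive when [c = 0]. *)
pose d := e / (K%:R * c + 1).
have den : 0 < K%:R * c + 1 by rewrite ltr_wpDl // mulr_ge0 // ltW.
have d0 : 0 < d by rewrite divr_gt0.
have approx i : exists p, PI p /\
    forall v, v \in block_vars blk i -> `|p v - x v| <= d.
  have [|p Pp px] := approx_on (x := x) (N := block_vars blk i) d0
      (@convex_hull_convex _ _ (@P R K Q)); last by exists p.
  by move=> a beta a0 aC; apply: cut; split=> //; exists i.
have [p Pp] := choice approx.
pose y := \sum_i restrict (block_vars blk i) (p i).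
have PIy : PI y.
  apply: (convex_hull_sum (A := fun i => restrict (block_vars blk i) @` @P R K Q)).
  - exact: index_enum_uniq.
  (* Each [f i] is the restriction of some point of [P], so the sum is feasible by
     [sum_restrict_feasible]. *)
  - move=> f Af; have /choice [g Pg] i : exists g, P g /\ restrict (block_vars blk i) g = f i.
      by have [|g Pg gf] := Af i; [rewrite mem_index_enum | exists g].
    rewrite (eq_bigr (fun i => restrict (block_vars blk i) (g i))).
      by apply: sum_restrict_feasible => // i; have [] := Pg i.
    by move=> i _; have [_ ->] := Pg i.
  - by move=> i _; apply: convex_hull_linear; have [] := Pp i.
apply: (@le_trans _ _ (objective y)%:E); first by apply: ereal_inf_lbound; exists y.
rewrite -EFinD lee_fin !objectiveE.
(* Each of the [K] summands is either within [d] of [x v] or zero, and [x v + d] is nonnegative. *)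
have yv v : y v <= K%:R * (x v + d).
  have -> : K%:R * (x v + d) = \sum_(i < K) (x v + d).
    by rewrite sumr_const card_ord mulr_natl.
  rewrite /y sum_ffunE; apply: ler_sum => i _; rewrite ffunE; case: ifP => vi.
    have [_ /(_ v vi)] := Pp i; rewrite ler_norml => /andP[_]; lra.
  by rewrite addr_ge0 // ltW.
apply: (@le_trans _ _ (\sum_v cost R v * (K%:R * (x v + d)))).
  by apply: ler_sum => v _; apply: ler_wpM2l => //; exact: cost_ge0.
have -> : \sum_v cost R v * (K%:R * (x v + d)) =
    K%:R * (\sum_v cost R v * x v) + K%:R * c * d.
  rewrite -mulrA /c mulr_suml !mulr_sumr -big_split /=.
  by apply: eq_bigr => v _; ring.
rewrite lerD2l /d mulrA ler_pdivrMr // [_ * e]mulrC ler_pM2l //.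
by rewrite lerDl.
Qed.
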